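(* Let $k$ be a field of characteristic zero, let $B=k[X_{1},\ldots,X_{n}]/I=k[x_{1},\ldots,x_{n}]$ be a finitely generated $k$-domain, and let $\partial\in\mathrm{LND}(B)$ be such that the plinth ideal $\mathrm{pl}(\partial)$ is generated by $m$ elements $f_1,\ldots,f_m$ as an ideal of $\ker\partial$. Let $\mathcal{F}=\{\mathcal{F}_i\}_{i\in\mathbb{N}}$ be the $\partial$-filtration of $B$. Choose $s_1,\ldots,s_m\in\mathcal{F}_1$ with $\partial(s_i)=f_i$, let $d_i=\deg_\partial(x_i)$ (with all $x_i\ne 0$), and define the $\mathbb{N}$-filtration $\mathcal{G}=\{\mathcal{G}_i\}_{i\in\mathbb{N}}$ of $B$ by $$\mathcal{G}_i=\sum_{j\le i}H_j,\qquad H_j=\sum_{u_1+\cdots+u_m+d_1v_1+\cdots+d_nv_n=j}\mathcal{F}_0\, s_1^{u_1}\cdots s_m^{u_m}x_1^{v_1}\cdots x_n^{v_n}\quad(u_a,v_b\in\mathbb{N}).$$ Then the filtrations $\mathcal{F}$ and $\mathcal{G}$ are equal if and only if $\mathcal{G}$ is proper.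
   Context: $\mathbb{N}=\mathbb{Z}_{\ge 0}$. A $k$-derivation $\partial$ of $B$ is locally nilpotent if for every $a\in B$ there is $N$ with $\partial^N(a)=0$; $\mathrm{LND}(B)$ is the set of these. The plinth ideal is $\mathrm{pl}(\partial)=\ker\partial\cap\partial(B)$, an ideal of $\ker\partial$. For $a\ne 0$, $\deg_\partial(a)=\min\{i\in\mathbb{N}\mid\partial^{i+1}(a)=0\}$, and $\deg_\partial(0)=-\infty$. The $\partial$-filtration is $\mathcal{F}_i=\ker\partial^{i+1}=\{a\in B\mid\deg_\partial(a)\le i\}$, so $\mathcal{F}_0=\ker\partial$. An $\mathbb{N}$-filtration of $B$ is a family $\{\mathcal{F}_i\}_{i\in\mathbb{N}}$ of $k$-subspaces with $\mathcal{F}_i\subset\mathcal{F}_{i+1}$, $B=\bigcup_i\mathcal{F}_i$, and $\mathcal{F}_i\mathcal{F}_j\subset\mathcal{F}_{i+j}$. It is proper if, in addition, $a\in\mathcal{F}_i\setminus\mathcal{F}_{i-1}$ and $b\in\mathcal{F}_j\setminus\mathcal{F}_{j-1}$ imply $ab\in\mathcal{F}_{i+j}\setminus\mathcal{F}_{i+j-1}$ (with $\mathcal{F}_{-1}=\{0\}$). *)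

(* Defs.v *)
From mathcomp Require Import all_boot all_order all_algebra.
From mathcomp Require Import mpoly.
Set Implicit Arguments.
Unset Strict Implicit.
Unset Printing Implicit Defensive.
Import GRing.Theory.
Local Open Scope ring_scope.

(* MathComp has no joint structure "k-algebra and integral domain", so B is a
   commutative k-algebra (whence 1 != 0) together with the axiom that a product
   vanishes only if one of the factors does. *)
Definition is_domain (k : fieldType) (B : comAlgType k) : Prop :=
  GRing.integral_domain_axiom B.

(* B = k[x_1, ..., x_n]: the k-algebra morphism k[X_1, ..., X_n] -> B sending
   X_i to x_i is onto; the ideal I is its kernel. *)
Definition generates_algebra (k : fieldType) (B : comAlgType k) (n : nat)
    (x : 'I_n -> B) : Prop :=
  forall b : B, exists p : {mpoly k[n]}, mmap (in_alg B) x p = b.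

Section Derivations.
Variables (k : fieldType) (B : comAlgType k).
Implicit Types (d : {linear B -> B}) (a b : B).

Definition derivation d : Prop := forall a b, d (a * b) = d a * b + a * d b.

Definition locally_nilpotent d : Prop := forall a, exists N, iter N d a = 0.

Definition LND d : Prop := derivation d /\ locally_nilpotent d.

Definition plinth d a : Prop := d a = 0 /\ exists b, d b = a.

(* The ideal of ker d generated by f_1, ..., f_m; meaningful when all the f_i
   lie in ker d. *)
Definition ker_ideal d (m : nat) (f : 'I_m -> B) a : Prop :=
  exists c : 'I_m -> B, (forall i, d (c i) = 0) /\ a = \sum_i c i * f i.

Lemma lnd_degree_subproof d (dLN : LND d) a :
  exists i, iter i.+1 d a == 0.
Proof.
by case: (dLN.2 a) => N Na; exists N; rewrite iterS Na linear0.
Qed.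

(* None stands for - oo. *)
Definition lnd_degree d (dLN : LND d) a : option nat :=
  if a == 0 then None else Some (ex_minn (lnd_degree_subproof dLN a)).

Definition lnd_filtration d : nat -> B -> Prop :=
  fun i a => iter i.+1 d a = 0.

End Derivations.

Section Filtrations.
Variables (k : fieldType) (B : comAlgType k).
Implicit Types (V : B -> Prop) (F : nat -> B -> Prop).

Definition subspace V : Prop :=
  V 0 /\ forall (c : k) (a b : B), V a -> V b -> V (c *: a + b).

Definition filtration F : Prop :=
  [/\ forall i, subspace (F i),
      forall i a, F i a -> F i.+1 a,
      forall a, exists i, F i a
    & forall i j a b, F i a -> F j b -> F (i + j)%N (a * b)].

(* F_{i-1}, with F_{-1} = {0}. *)
Definition filtration_pred F (i : nat) : B -> Prop :=
  if i is j.+1 then F j else fun a => a = 0.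

Definition proper_filtration F : Prop :=
  filtration F /\
  forall i j a b,
    F i a -> ~ filtration_pred F i a ->
    F j b -> ~ filtration_pred F j b ->
    F (i + j)%N (a * b) /\ ~ filtration_pred F (i + j)%N (a * b).

(* The sum of the subsets V t of B (t satisfying P): all finite sums of elements
   of the V t. *)
Definition sum_of (T : Type) (P : T -> Prop) (V : T -> B -> Prop) : B -> Prop :=
  fun b => exists (r : nat) (t : 'I_r -> T) (a : 'I_r -> B),
    (forall l, P (t l) /\ V (t l) (a l)) /\ b = \sum_l a l.

End Filtrations.

Section GeneratedFiltration.
Variables (k : fieldType) (B : comAlgType k) (F0 : B -> Prop).
Variables (m n : nat) (s : 'I_m -> B) (x : 'I_n -> B) (e : 'I_n -> nat).

Definition gen_weight (u : 'I_m -> nat) (v : 'I_n -> nat) : nat :=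
  (\sum_a u a + \sum_b e b * v b)%N.

Definition gen_monomial (u : 'I_m -> nat) (v : 'I_n -> nat) : B :=
  (\prod_a s a ^+ u a) * \prod_b x b ^+ v b.

Definition gen_piece (j : nat) : B -> Prop :=
  sum_of (fun uv : ('I_m -> nat) * ('I_n -> nat) => gen_weight uv.1 uv.2 = j)
    (fun uv b => exists c, F0 c /\ b = c * gen_monomial uv.1 uv.2).

Definition gen_filtration (i : nat) : B -> Prop :=
  sum_of (fun j : nat => (j <= i)%N) gen_piece.

End GeneratedFiltration.

(* Main.v *)
(* G_i is always contained in F_i. If G is proper, multiplication by a nonzero
   element of F_0 preserves the G-degree; and if f = d s <> 0 lies in ker d, then
   (i+1)! f^(i+1) b - d^(i+1)(b) s^(i+1) lies in F_i for every b in F_(i+1), so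
   F_(i+1) is contained in G_(i+1) by induction on i. Conversely, F is proper
   because the top term of Leibniz' formula for d^(i+j)(a b) is
   C(i+j, i) d^i(a) d^j(b). *)
Require Import Defs.
From mathcomp Require Import all_boot all_order all_algebra.
From mathcomp Require Import mpoly.
From Stdlib Require Import Classical FunctionalExtensionality PropExtensionality.
Import GRing.Theory.
Local Open Scope ring_scope.

(** * Sums of subsets and subspaces *)

Section SumOf.
Variables (k : fieldType) (B : comAlgType k).

Lemma sum_of_mem (T : Type) (P : T -> Prop) (V : T -> B -> Prop) t b :
  P t -> V t b -> sum_of P V b.
Proof.
by move=> Pt Vb; exists 1%N, (fun=> t), (fun=> b); split=> //; rewrite big_ord1.
Qed.

Lemma subspace_add (W : B -> Prop) a b : subspace W -> W a -> W b -> W (a + b).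
Proof. by case=> _ /(_ 1 a b) WD Wa Wb; rewrite -[a]scale1r; apply: WD. Qed.

Lemma sum_of_sub (T : Type) (P : T -> Prop) (V : T -> B -> Prop)
    (W : B -> Prop) b :
  subspace W -> (forall t a, P t -> V t a -> W a) -> sum_of P V b -> W b.
Proof.
move=> sW VW [r [t [a [PVa ->]]]].
elim/big_ind: _ => [|u v|l _]; first by case: sW.
  exact: subspace_add.
by case: (PVa l); apply: VW.
Qed.

End SumOf.

(** * Filtrations and cancellation under properness *)

Section Filtration.
Variables (k : fieldType) (B : comAlgType k) (F : nat -> B -> Prop).
Hypothesis filtF : filtration F.

Lemma filtration_le i j a : (i <= j)%N -> F i a -> F j a.
Proof.
case: filtF => _ FS _ _; elim: j => [|j IHj]; first by rewrite leqn0 => /eqP->.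
by rewrite leq_eqVlt => /predU1P[->//|/IHj Fij /Fij]; apply: FS.
Qed.

Lemma filtration_exp i a l : F 0%N 1 -> F i a -> F (i * l)%N (a ^+ l).
Proof.
case: filtF => _ _ _ FM F1 Fa; elim: l => [|l IHl]; first by rewrite muln0.
by rewrite mulnS exprS; apply: FM.
Qed.

Lemma filtration_prod l (w : 'I_l -> nat) (a : 'I_l -> B) :
  F 0%N 1 -> (forall j, F (w j) (a j)) -> F (\sum_j w j)%N (\prod_j a j).
Proof.
case: filtF => _ _ _ FM F1 Fa.
by elim/big_rec2: _ => // j ? ? _; apply: FM.
Qed.

End Filtration.

(** Start from some level containing [b] and descend. If [b] had exact degree [j.+1 > i], properness
    would give [c * b] that same degree, contradicting [F i (c * b)]. *)
Lemma proper_filtration_cancel (k : fieldType) (B : comAlgType k)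
    (F : nat -> B -> Prop) i c b :
  proper_filtration F -> F 0%N c -> c != 0 -> F i (c * b) -> F i b.
Proof.
move=> [filtF propF] Fc c0 Fcb; have [_ _ Fex _] := filtF.
have [j Fb] := Fex b; elim: j Fb => [|j IHj] Fb; first exact: filtration_le Fb.
have [ltij|leji] := ltnP i j.+1; last exact: filtration_le Fb.
have [/IHj//|nFb] := classic (F j b).
(* By the convention F_{-1} = {0}, a nonzero [c] in [F 0] has degree exactly 0. *)
have nc : ~ filtration_pred F 0 c by apply/eqP.
have [_ /=] := propF 0%N j.+1 c b Fc nc Fb nFb.
by case; apply: filtration_le Fcb.
Qed.

(** * The filtration generated by weighted monomials *)

Section GeneratedFiltration.
Variables (k : fieldType) (B : comAlgType k) (F0 : B -> Prop).
Variables (m n : nat) (s : 'I_m -> B) (x : 'I_n -> B) (e : 'I_n -> nat).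

Lemma gen_filtration_monomial c u v :
  F0 c -> gen_filtration F0 s x e (gen_weight e u v) (c * gen_monomial s x u v).
Proof.
move=> F0c; apply: (sum_of_mem _ _ _ _ _ (gen_weight e u v)) => //.
by apply: (sum_of_mem _ _ _ _ _ (u, v)) => //; exists c.
Qed.

Lemma gen_filtration0 c : F0 c -> gen_filtration F0 s x e 0 c.
Proof.
move=> /(gen_filtration_monomial _ (fun=> 0%N) (fun=> 0%N)).
rewrite /gen_weight /gen_monomial !big1 ?mulr1 // => b _; exact: muln0.
Qed.

Lemma gen_filtration1 a : F0 1 -> gen_filtration F0 s x e 1 (s a).
Proof.
(* The boolean [b == a], read as 0 or 1, is the exponent vector of the single factor [s a]. *)
move=> /(gen_filtration_monomial _ (fun b => b == a) (fun=> 0%N)).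
rewrite /gen_weight /gen_monomial mul1r.
rewrite (bigD1 a) //= (bigD1 (F := fun b => s b ^+ _) a) //= eqxx.
rewrite !big1 ?mulr1 //.
- by move=> b /negPf->.
- by move=> b _; rewrite muln0.
- by move=> b /negPf->.
Qed.

(** Each generator lies in the level of [F] given by its weight, so multiplicativity of [F] puts
    every monomial of weight [j] in [F j]. *)
Lemma gen_filtration_sub (F : nat -> B -> Prop) i b :
  filtration F -> F 0%N 1 -> (forall c, F0 c -> F 0%N c) ->
  (forall a, F 1%N (s a)) -> (forall a, F (e a) (x a)) ->
  gen_filtration F0 s x e i b -> F i b.
Proof.
move=> filtF F1 F0F Fs Fx; have [Fsub _ _ FM] := filtF.
apply: sum_of_sub => // j a leji Ha; apply: filtration_le leji _ => //.
apply: sum_of_sub Ha => // -[u v] _ /= wj [c [/F0F Fc ->]].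
rewrite -[j]add0n; apply: (FM) => //; rewrite -wj; apply: FM.
  apply: filtration_prod => // l; rewrite -[X in F X]mul1n.
  exact: (filtration_exp _ _ F).
by apply: filtration_prod => // l; apply: (filtration_exp _ _ F).
Qed.

End GeneratedFiltration.

(** * Leibniz' formula and the filtration of a derivation *)

Section Derivation.
Variables (k : fieldType) (B : comAlgType k) (d : {linear B -> B}).
Hypothesis derd : derivation d.

Lemma derivation1 : d 1 = 0.
Proof.
have /eqP := derd 1 1; rewrite !(mulr1, mul1r).
by rewrite -subr_eq0 opprD addNKr oppr_eq0 => /eqP.
Qed.

Lemma iter_linear0 l : iter l d 0 = 0.
Proof. by elim: l => //= l ->; rewrite linear0. Qed.

Lemma iter_linearP l c a b :
  iter l d (c *: a + b) = c *: iter l d a + iter l d b.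
Proof. by elim: l => //= l ->; rewrite linearP. Qed.

Lemma iter_ker_mul l c a : d c = 0 -> iter l d (c * a) = c * iter l d a.
Proof. by move=> dc; elim: l => //= l ->; rewrite derd dc mul0r add0r. Qed.

(** In the Leibniz expansion each term differentiates [a] at least [p] times or [b] at least [q]
    times. The induction on [l] avoids writing out the expansion. *)
Lemma iter_mul_vanish l p q a b :
  iter p d a = 0 -> iter q d b = 0 -> (p + q <= l.+1)%N -> iter l d (a * b) = 0.
Proof.
elim: l p q a b => [|l IHl] [|p] [|q] a b pa qb //; rewrite ?addSn ?addnS //.
- by rewrite [a]pa mul0r.
- by rewrite [a]pa mul0r.
- by rewrite [b]qb mulr0.
- by rewrite [a]pa mul0r iter_linear0.
- by rewrite [a]pa mul0r iter_linear0.
- by rewrite [b]qb mulr0 iter_linear0.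
rewrite !ltnS => lepq; rewrite iterSr derd -[_ * b]scale1r iter_linearP.
rewrite (IHl p q.+1) // -?iterSr ?addnS //.
by rewrite (IHl p.+1 q) -?iterSr ?addSn // scaler0 addr0.
Qed.

Lemma iter_mul_top i j a b :
  lnd_filtration d i a -> lnd_filtration d j b ->
  iter (i + j) d (a * b) = (iter i d a * iter j d b) *+ 'C(i + j, i).
Proof.
rewrite /lnd_filtration.
have [l] := ubnP (i + j)%N; elim: l i j a b => // l IHl [|i] [|j] a b + Fa Fb.
- by rewrite bin0 mulr1n.
- by rewrite bin0 mulr1n add0n iter_ker_mul.
- by rewrite addn0 binn mulr1n mulrC iter_ker_mul // mulrC.
(* Pascal's rule matches the two summands of [d (a * b)]: [d a * b] has bounds [i], [j.+1], and
   [a * d b] has bounds [i.+1], [j]. *)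
rewrite addSn !ltnS => leij; rewrite binS mulrnDr iterSr derd.
rewrite -[_ * b]scale1r iter_linearP scale1r.
rewrite (IHl i j.+1) -?iterSr // -addSnnS.
by rewrite (IHl i.+1 j) -?iterSr ?addSnnS // addrC.
Qed.

(** For [i = 0] the convention F_{-1} = {0} agrees with [iter 0 d a = a], so degree exactly [i]
    needs no case split later. *)
Lemma lnd_filtration_predE i a :
  filtration_pred (lnd_filtration d) i a <-> iter i d a = 0.
Proof. by case: i. Qed.

Lemma lnd_filtration_filtration :
  locally_nilpotent d -> filtration (lnd_filtration d).
Proof.
move=> nilp; split=> [i|i a Fa|a|i j a b Fa Fb].
- split=> [|c a b Fa Fb]; first exact: iter_linear0.
  by rewrite /lnd_filtration iter_linearP Fa Fb scaler0 addr0.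
- by rewrite /lnd_filtration iterS Fa linear0.
- by have [N Na] := nilp a; exists N; rewrite /lnd_filtration iterS Na linear0.
- by apply: iter_mul_vanish Fa Fb _; rewrite addSn addnS.
Qed.

Hypothesis k_char0 : [pchar k] =i pred0.

Lemma char0_mulrn_eq0 (a : B) l : (a *+ l.+1 == 0) = (a == 0).
Proof. by rewrite -scaler_nat scaler_eq0 (pcharf0P _).1. Qed.

Hypothesis B_domain : is_domain B.

Lemma domain_mul_neq0 (a b : B) : a != 0 -> b != 0 -> a * b != 0.
Proof. by move=> a0 b0; apply/eqP => /B_domain; rewrite (negPf a0) (negPf b0). Qed.

Lemma lnd_filtration_proper :
  locally_nilpotent d -> proper_filtration (lnd_filtration d).
Proof.
move=> nilp; have filtF := lnd_filtration_filtration nilp.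
have [_ _ _ FM] := filtF; split=> // i j a b Fa na Fb nb.
split; first exact: FM.
rewrite lnd_filtration_predE iter_mul_top //.
(* The binomial coefficient is written as a successor, hence is invertible in characteristic
   zero. *)
have := bin_gt0 (i + j) i; rewrite leq_addr; case: 'C(_, _) => // N _.
apply/eqP; rewrite char0_mulrn_eq0; apply: domain_mul_neq0; apply/eqP.
  by move/lnd_filtration_predE.
by move/lnd_filtration_predE.
Qed.

(** Splitting [s ^+ i.+1] as [s * s ^+ i], the top Leibniz term contributes the factor C(i+1, 1) =
    i+1; these factors build up the factorial. *)
Lemma iter_slice_exp s i :
  d (d s) = 0 -> iter i d (s ^+ i) = d s ^+ i *+ i`!.
Proof.
move=> dds; have Fs l : lnd_filtration d l (s ^+ l).
  elim: l => [|l IHl]; first exact: derivation1.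
  by rewrite exprS; apply: (iter_mul_vanish l.+2 2 l.+1); rewrite ?add2n.
elim: i => [|i IHi]; first by rewrite mulr1n.
rewrite exprS -[i.+1]add1n (iter_mul_top 1 i) //= IHi.
by rewrite bin1 add1n exprS factS mulrnAr mulnC mulrnA.
Qed.

Lemma ker_exp c i : d c = 0 -> d (c ^+ i) = 0.
Proof.
move=> dc; elim: i => [|i IHi]; first exact: derivation1.
by rewrite exprS derd dc IHi mul0r mulr0 addr0.
Qed.

Lemma lnd_filtration_sub (G : nat -> B -> Prop) (s : B) :
  proper_filtration G -> (forall c, d c = 0 -> G 0%N c) ->
  G 1%N s -> d (d s) = 0 -> d s != 0 ->
  forall i b, lnd_filtration d i b -> G i b.
Proof.
move=> propG G0 G1 dds ds0; have [filtG _] := propG; have [Gsub _ _ GM] := filtG.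
have dfact i : d (d s ^+ i *+ i`!) = 0 by rewrite linearMn ker_exp ?mul0rn.
elim=> [|i IHi] b Fb; first exact: G0.
(* Since [c] and [g] lie in the kernel, [iter i.+1 d] sends both [c * b] and [g * s ^+ i.+1] to
   [c * g], so their difference drops to level [i]. *)
pose c := d s ^+ i.+1 *+ i.+1`!; pose g := iter i.+1 d b.
apply: (proper_filtration_cancel _ _ _ _ c) => //; first exact/G0/dfact.
  rewrite /c; case: (i.+1`!) (fact_gt0 i.+1) => // N _; rewrite char0_mulrn_eq0.
  elim: i.+1 => [|l IHl]; first by rewrite oner_neq0.
  by rewrite exprS domain_mul_neq0.
have -> : c * b = (- 1) *: (g * s ^+ i.+1) + c * b + g * s ^+ i.+1.
  by rewrite scaleN1r addrAC addNr add0r.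
have Ggs : G i.+1 (g * s ^+ i.+1).
  rewrite -[i.+1]add0n; apply: GM; first exact: G0.
  by rewrite -[X in G X]mul1n; apply: (filtration_exp _ _ G) => //; apply/G0/derivation1.
apply: subspace_add => //; apply: (filtration_le _ _ _ filtG i) => //.
apply: IHi; rewrite /lnd_filtration iter_linearP iter_ker_mul //.
rewrite (iter_ker_mul _ c); last exact: dfact.
by rewrite iter_slice_exp // mulrC scaleN1r addNr.
Qed.

(** The last nonzero iterate of [d] on [b], if it is not [b] itself, belongs to the plinth ideal; a
    zero plinth ideal thus forces [d b = 0]. *)
Lemma lnd_filtration_plinth0 i b :
  (forall a, plinth d a -> a = 0) -> lnd_filtration d i b -> d b = 0.
Proof.
move=> pl0; elim: i => // i IHi Fb; apply: IHi; apply: pl0; split=> //.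
by exists (iter i d b).
Qed.

End Derivation.

Lemma lnd_degree_filtration (k : fieldType) (B : comAlgType k)
    (d : {linear B -> B}) (dLN : LND d) a i :
  lnd_degree dLN a = Some i -> lnd_filtration d i a.
Proof.
rewrite /lnd_degree; case: ifP => // _ [<-].
by case: ex_minnP => j /eqP.
Qed.

Theorem lemma2p3 (k : fieldType) (k_char0 : [pchar k] =i pred0)
    (B : comAlgType k) (B_domain : is_domain B)
    (n : nat) (x : 'I_n -> B) (x_gen : generates_algebra x)
    (x_neq0 : forall b, x b != 0)
    (d : {linear B -> B}) (dLN : LND d)
    (m : nat) (f : 'I_m -> B)
    (f_plinth : forall a, plinth d (f a))
    (f_gen : forall a, plinth d a <-> ker_ideal d f a)
    (s : 'I_m -> B)
    (s_F1 : forall a, lnd_filtration d 1 (s a))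
    (s_f : forall a, d (s a) = f a)
    (e : 'I_n -> nat)
    (e_deg : forall b, lnd_degree dLN (x b) = Some (e b)) :
  let F := lnd_filtration d in
  let G := gen_filtration (F 0%N) s x e in
  (forall i b, F i b <-> G i b) <-> proper_filtration G.
Proof.
move=> F G; have [derd nilp] := dLN.
split=> [FG|propG i b].
  suff -> : G = F by apply: lnd_filtration_proper.
  apply: functional_extensionality => i; apply: functional_extensionality => b.
  by apply: propositional_extensionality; split=> /FG.
have F01 : F 0%N 1 by apply: derivation1.
split; last first.
  apply: gen_filtration_sub => //; first exact: lnd_filtration_filtration.
  by move=> a; apply: lnd_degree_filtration (e_deg a).
have G0 c : d c = 0 -> G 0%N c by move=> dc; apply: gen_filtration0.
(* A nonzero [f a] makes [s a] a local slice. Otherwise, including when [m = 0], the plinth ideal is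
   zero and every [F i] collapses to [F 0]. *)
have [a fa0|f0] := pickP (fun a => f a != 0).
  apply: (lnd_filtration_sub k B d derd k_char0 B_domain G (s a)) => //.
  - exact: gen_filtration1.
  - exact: s_F1.
  - by rewrite s_f.
move=> Fb; have [filtG _] := propG.
apply: (filtration_le _ _ _ filtG 0) => //; apply/G0/lnd_filtration_plinth0/Fb.
move=> a /f_gen[c [_ ->]]; apply: big1 => j _.
by have /negbFE/eqP-> := f0 j; rewrite mulr0.
Qed.
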